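(* The typical continuous function on $[0,1]$ satisfies Property (b') but is not monotonically increasing on any interval. That is, the set of all $f\in C[0,1]$ such that (i) for each $x_0\in[0,1]$ the set $$E=\left\{x\in[0,1]\setminus\{x_0\}:\frac{f(x)-f(x_0)}{x-x_0}\geq0\right\}$$ does not have zero density at $x_0$, and (ii) there is no nondegenerate interval $I\subset[0,1]$ on which $f$ is monotonically increasing, is residual in $C[0,1]$.
   Context: $C[0,1]$ is the complete metric space of all continuous functions $f:[0,1]\to\mathbb{R}$ with the sup metric. A subset of $C[0,1]$ is residual if its complement is of the first Baire category (meager) in $C[0,1]$; a property is typical if the set of functions enjoying it is residual. ''Monotonically increasing'' is meant in the non-strict sense ($x<y$ implies $f(x)\le f(y)$). With $\lambda$ denoting Lebesgue measure on $\mathbb{R}$, the density of a measurable set $E$ in an interval $I$ is $\Delta(E,I)=\lambda(E\cap I)/\lambda(I)$; the upper density of $E$ at $x$ is $\overline\Delta(E,x)=\limsup_{r\to0}\Delta(E,(x-r,x+r))$, with $r>0$. The lower density is defined with $\liminf$, and if the two agree the common value is the density of $E$ at $x$. Thus $E$ does not have zero density at $x_0$ precisely when $\overline\Delta(E,x_0)>0$. *)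

(* Defs.v *)
From HB Require Import structures.
From mathcomp Require Import all_boot all_order all_algebra.
From mathcomp Require Import all_classical all_reals all_analysis.

Set Implicit Arguments.
Unset Strict Implicit.
Unset Printing Implicit Defensive.
Import Order.TTheory GRing.Theory Num.Theory.
Import numFieldNormedType.Exports.
Local Open Scope classical_set_scope.
Local Open Scope ring_scope.

(* The subtype, with the topology induced from R, so that an element of
   C01 R has no values outside of [0,1]. *)
Definition I01 (R : realType) : topologicalType := set_type (`[0, 1]%classic : set R).

Definition pt {R : realType} (x : I01 R) : R := set_val x.

Definition C01 (R : realType) : Type := continuousType (I01 R) R.

HB.instance Definition _ (R : realType) := Choice.on (C01 R).

Definition sup_dist {R : realType} (f g : C01 R) : R :=
  sup (range (fun x : I01 R => `|f x - g x|)).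

Section sup_dist_theory.
Context {R : realType}.
Implicit Types f g h : C01 R.

Local Lemma sup_dist_has_ubound f g :
  has_ubound (range (fun x : I01 R => `|f x - g x|)).
Proof.
pose k : I01 R -> R := fun x => `|f x - g x|.
have ck : continuous k.
  move=> x; have fx := @cts_fun _ _ f x; have gx := @cts_fun _ _ g x.
  exact: cvg_norm (cvgB fx gx).
have /(@EVT_max R _ 0 1 ler01)[c _ cmax] :
    {within `[0, 1], continuous (valL_ 0 k)}.
  exact/subspace_valL_continuousP'.
exists (valL_ 0 k c) => _ [x _ <-].
have kE : valL_ 0 k (set_val x) = k x.
  exact: (congr1 (fun h : I01 R -> R => h x) (@valLK _ _ 0 `[0, 1]%classic k)).
rewrite -[leLHS]/(k x) -kE.
have x01 : set_val x \in `[0, 1]%R by have := set_valP x.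
exact: cmax x01.
Qed.

Lemma sup_dist_ge f g (x : I01 R) : `|f x - g x| <= sup_dist f g.
Proof. by apply: ub_le_sup; [exact: sup_dist_has_ubound|exists x]. Qed.

Local Lemma I01_0_subproof : (0 : R) \in (`[0, 1]%classic : set R).
Proof. by rewrite inE /= in_itv /= lexx ler01. Qed.

Lemma sup_dist_le f g (e : R) :
  (forall x : I01 R, `|f x - g x| <= e) -> sup_dist f g <= e.
Proof.
move=> fge; apply: ge_sup => [|_ [x _ <-]]; last exact: fge.
by exists `|f (SigSub I01_0_subproof) - g (SigSub I01_0_subproof)|,
  (SigSub I01_0_subproof).
Qed.

Local Lemma sup_distxx f : sup_dist f f = 0.
Proof.
apply/eqP; rewrite eq_le; apply/andP; split.
  by apply: sup_dist_le => x; rewrite subrr normr0.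
exact: le_trans (sup_dist_ge _ _ (SigSub I01_0_subproof)).
Qed.

Local Lemma sup_dist_positivity f g : sup_dist f g = 0 -> f = g.
Proof.
move=> fg0; apply/continuousEP => x; apply/eqP.
by rewrite -subr_eq0 -normr_le0 -fg0 sup_dist_ge.
Qed.

Local Lemma sup_dist_sym f g : sup_dist f g = sup_dist g f.
Proof.
by congr sup; apply: eq_imagel => x _; rewrite distrC.
Qed.

Local Lemma sup_dist_triangle g f h :
  sup_dist f h <= sup_dist f g + sup_dist g h.
Proof.
apply: sup_dist_le => x.
have := ler_distD (g x) (f x) (h x); move/le_trans; apply.
by apply: lerD; exact: sup_dist_ge.
Qed.

HB.instance Definition _ := @isMetric.Build R (C01 R) (@sup_dist R)
  sup_distxx sup_dist_positivity sup_dist_sym sup_dist_triangle.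

End sup_dist_theory.

Definition nowhere_dense {T : topologicalType} (A : set T) : Prop :=
  interior (closure A) = set0.

Definition meager {T : topologicalType} (A : set T) : Prop :=
  exists F : nat -> set T,
    (forall n, nowhere_dense (F n)) /\ A = \bigcup_n F n.

Definition residual {T : topologicalType} (A : set T) : Prop := meager (~` A).

Section density.
Context {R : realType}.
Local Open Scope ereal_scope.

Definition density_in (E I : set R) : \bar R :=
  lebesgue_measure (E `&` I) / lebesgue_measure I.

(* The window ]x - r, x + r[ is never truncated to [0,1], so a set contained in
   [0,1] has upper density at most 1/2 at the endpoints 0 and 1. *)
Definition upper_density (E : set R) (x : R) : \bar R :=
  limf_esup (fun r : R => density_in E `](x - r)%R, (x + r)%R[) 0%R^'+.

Definition lower_density (E : set R) (x : R) : \bar R :=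
  limf_einf (fun r : R => density_in E `](x - r)%R, (x + r)%R[) 0%R^'+.

Definition has_density (E : set R) (x : R) (d : \bar R) : Prop :=
  upper_density E x = d /\ lower_density E x = d.

End density.

Definition nonneg_slope_set {R : realType} (f : C01 R) (x0 : I01 R) : set R :=
  [set pt x | x in
    [set x : I01 R | x <> x0 /\ 0 <= (f x - f x0) / (pt x - pt x0)]].

(* Increasing in the non-strict sense. *)
Definition increasing_on {R : realType} (f : C01 R) (I : set R) : Prop :=
  forall x y : I01 R, I (pt x) -> I (pt y) -> pt x < pt y -> f x <= f y.

Definition nondegenerate_interval {R : realType} (I : set R) : Prop :=
  is_interval I /\ exists x y : R, [/\ I x, I y & x < y].

(* Main.v *)
Require Import Defs.
From mathcomp Require Import all_boot all_order all_algebra.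
From mathcomp Require Import all_classical all_reals all_analysis.
From mathcomp Require Import ring lra.
Import Order.TTheory GRing.Theory Num.Theory.
Import numFieldNormedType.Exports.
Local Open Scope classical_set_scope.
Local Open Scope ring_scope.

(** A function that fails one of the two properties is bad at some scale
    [1/(n+1)]: either there is a point [x0] such that the points of nonnegative
    slope fill less than 1/12 of every window around [x0] of radius below
    [1/(n+1)], or the function is increasing on an interval of length at least
    [1/(n+1)].  So it suffices that, for each [n], the functions bad at scale
    [1/(n+1)] are nowhere dense ([nowhere_dense_exceptional]), that is, that
    every ball of C[0,1] contains a ball without such functions.

    Given [f] and a small amplitude [A], the centre of that ball is
    [f + A * wave (m x)], where [wave u = - cos (pi u)] and [m] is a large odd
    integer; large enough for [f] to be nearly constant over a few periods.
    Functions close to it follow the zigzag.  A function that follows the zigzag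
    decreases somewhere on each interval a few periods long, so it is not
    increasing there ([waved_not_increasing]).  As for slopes
    ([waved_not_sparse]): from a point [x0] in the lower half of the zigzag one
    sees, to the right, the top third of a rising stretch, and from a point in the
    upper half one sees, to the left, the bottom third of a rising stretch
    ([wave_sees_rise]).  All points of that third have nonnegative slope relative
    to [x0], and they fill 1/12 of a window of radius [2/m].  Because [m] is odd, the
    zigzag starts and ends with a rising stretch, so the third that is needed
    exists for all [x0], even near the endpoints of [0,1]. *)

(** * Meager and residual sets *)

Lemma nowhere_dense_ball (K : numFieldType) (M : metricType K) (A : set M) :
  (forall (x : M) (e : K), 0 < e -> exists y, mdist x y < e /\
     exists2 d : K, 0 < d & forall z, mdist y z < d -> ~ A z) ->
  nowhere_dense A.
Proof.
move=> hA; apply/seteqP; split=> // x /nbhs_ballP[e /= e0 xA].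
have [y [xy [d d0 ydA]]] := hA x e e0.
have /xA/= clAy : ball x e y by rewrite -metricType_numDomainType.ball_mdistE.
have [z [Az yz]] := clAy _ (nbhsx_ballx y d d0).
by move: yz; rewrite -metricType_numDomainType.ball_mdistE => /ydA.
Qed.

Lemma nowhere_denseS (T : topologicalType) (A B : set T) :
  A `<=` B -> nowhere_dense B -> nowhere_dense A.
Proof.
move=> AB B0; apply/seteqP; split=> // x.
by move=> /(interiorS (closureS AB)); rewrite B0.
Qed.

Lemma residual_of_nowhere_dense_cover (T : topologicalType) (A : set T)
    (F : nat -> set T) :
  (forall n, nowhere_dense (F n)) -> ~` A `<=` \bigcup_n F n -> residual A.
Proof.
move=> F0 AF; exists (fun n => F n `&` ~` A); split.
  by move=> n; apply: nowhere_denseS (F0 n) => x [].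
apply/seteqP; split=> [x nAx|x [n _ []]//].
by have [n _ Fnx] := AF x nAx; exists n.
Qed.

(** * Lower bounds for densities *)

Section density.
Context {R : realType}.

(** On arbitrary sets the function underlying [lebesgue_measure] is the outer
    measure, which is monotone; so the sets of points with nonnegative slope
    never have to be shown measurable. *)
Lemma le_lebesgue_measure (A B : set R) : A `<=` B ->
  (lebesgue_measure A <= lebesgue_measure B)%E.
Proof. by move=> AB; apply: (@le_mu_ext _ (ocitv_type R) R (wlength idfun)). Qed.

Lemma density_in_ge (E : set R) (x r a b : R) : 0 < r -> a <= b ->
  `[a, b] `<=` E -> `[a, b] `<=` `](x - r)%R, (x + r)%R[ ->
  (((b - a) / (2 * r))%:E <= density_in E `](x - r)%R, (x + r)%R[)%E.
Proof.
move=> r0 ab abE abI; rewrite /density_in.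
have -> : lebesgue_measure (`](x - r)%R, (x + r)%R[ : set R) = (2 * r)%:E.
  rewrite lebesgue_measure_itv /= lte_fin ifT; last by lra.
  by rewrite -EFinB; congr EFin; ring.
rewrite inver gt_eqF; last by lra.
rewrite lee_pdivlMr; last by lra.
rewrite -EFinM divfK; last by rewrite gt_eqF//; lra.
have -> : (b - a)%:E = lebesgue_measure (`[a, b] : set R).
  rewrite lebesgue_measure_itv /= lte_fin; case: ltP => [_|ba].
    by rewrite EFinB.
  by congr EFin; lra.
by apply: le_lebesgue_measure => t tab; split; [exact: abE|exact: abI].
Qed.

Lemma has_density0_lt (E : set R) (x c : R) : 0 < c -> has_density E x 0%E ->
  \forall r \near 0^'+, (density_in E `](x - r)%R, (x + r)%R[ < c%:E)%E.
Proof.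
move=> c0 [+ _]; rewrite /upper_density /limf_esup => E0.
have : (ereal_inf [set ereal_sup [set density_in E `](x - r)%R, (x + r)%R[ | r in V]
    | V in (0 : R)^'+] < c%:E)%E by rewrite E0 lte_fin.
move=> /ereal_inf_lt[_ [V V0 <-] Vc].
apply: filterS V0 => r Vr; apply: le_lt_trans Vc.
by apply: ereal_sup_ubound; exists r.
Qed.

End density.

(** * Continuous functions on the unit interval *)

Section unit_interval.
Context {R : realType}.

Lemma pt_ge0 (x : I01 R) : 0 <= pt x.
Proof. by have := set_valP x; rewrite /= in_itv => /andP[]. Qed.

Lemma pt_le1 (x : I01 R) : pt x <= 1.
Proof. by have := set_valP x; rewrite /= in_itv => /andP[]. Qed.

Lemma pt_surj (x : R) : 0 <= x <= 1 -> exists y : I01 R, pt y = x.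
Proof.
move=> x01; have x01' : x \in (`[0, 1]%classic : set R) by rewrite inE /= in_itv.
by exists (SigSub x01').
Qed.

Lemma pt_continuous : continuous (@pt R).
Proof. exact: initial_continuous. Qed.

(** Heine's theorem, by the compactness of [0,1]: the condition [P d z] holds for
    all [d] small and all reals near any given point of [0,1], hence for all small
    [d] at every point at once. *)
Lemma C01_unif_continuous (f : C01 R) (e : R) : 0 < e ->
  \forall d \near 0^'+, forall x y : I01 R, `|pt x - pt y| < d -> `|f x - f y| < e.
Proof.
move=> e0.
pose P (d : R) (z : R) := forall x y : I01 R,
  `|z - pt x| < d -> `|z - pt y| < d -> `|f x - f y| < e.
have : \forall d \near 0^'+, `[0, 1]%classic `<=` P d.
  apply: (compact_near_coveringP _).1 => [|z1 z01].
    exact: segment_compact.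
  rewrite /= in_itv /= in z01; have [z zE] := pt_surj _ z01; rewrite -{}zE {z1 z01}.
  have : nbhs z [set x | `|f z - f x| < e / 2].
    have e2 : 0 < e / 2 by lra.
    have /cvgrPdist_lt/(_ _ e2) := @cts_fun _ _ f z.
    exact.
  rewrite nbhsE => -[_ [[B oB <-] /= Bz] Bf].
  have /nbhs_ballP[r /= r0 rB] : nbhs (pt z) B by exact: open_nbhs_nbhs.
  have fz x : `|pt z - pt x| < r -> `|f z - f x| < e / 2.
    by move=> zx; apply: Bf; apply: rB.
  near=> z' d => x y zx zy.
  have zz' : `|pt z - z'| < r / 2 by near: z'; apply: nbhsx_ballx; lra.
  have dr : d < r / 2 by near: d; apply: nbhs_right_lt; lra.
  have {}fz t : `|z' - pt t| < d -> `|f z - f t| < e / 2.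
    by move=> zt; apply: fz; move: zz' zt; rewrite !ltr_norml; lra.
  by move: (fz _ zx) (fz _ zy); rewrite !ltr_norml; lra.
move=> Pd; near=> d => x y xy; apply: (near Pd d _ (pt x)) => //.
  by rewrite /= in_itv /= pt_ge0 pt_le1.
by rewrite subrr normr0; near: d; exact: nbhs_right_gt.
Unshelve. all: by end_near.
Qed.
End unit_interval.

Lemma mem_slope (R : realType) (f : C01 R) (x0 : I01 R) (x : I01 R) :
  (pt x0 < pt x /\ f x0 <= f x) \/ (pt x < pt x0 /\ f x <= f x0) ->
  nonneg_slope_set f x0 (pt x).
Proof.
move=> h; exists x => //=; split.
  by move=> xx0; rewrite xx0 in h; case: h; rewrite ltxx; case.
case: h => -[lx lf]; first by apply: divr_ge0; lra.
by rewrite -mulrNN -invrN; apply: divr_ge0; lra.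
Qed.

(** * The cosine zigzag *)

Section wave.
Context {R : realType}.
Implicit Types u v : R.

(** A zigzag that starts at a minimum and whose half-period is 1: it rises on
    each [[2k, 2k+1]] and falls on each [[2k+1, 2k+2]]. *)
Definition wave u : R := - cos (pi * u).

(** On the first third of a rising stretch the wave is at most [- rise], on the
    last third at least [rise]. *)
Definition rise : R := cos (pi / 3).

Lemma rise_gt0 : 0 < rise.
Proof. by apply: cos_gt0_pihalf; have := pi_gt0 R; lra. Qed.

Lemma norm_wave_le1 u : `|wave u| <= 1.
Proof. by rewrite normrN cos_max. Qed.

Lemma wave_continuous : continuous wave.
Proof.
move=> u; apply: cvgN; apply: (@continuous_comp _ _ _ (fun u => pi * u) cos).
  exact: mulrl_continuous.
exact: continuous_cos.
Qed.

Lemma waveD2n (k : nat) v : wave (2 * k%:R + v) = wave v.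
Proof.
congr (- _); have -> : pi * (2 * k%:R + v) = pi * v + (pi *+ 2) *+ k.
  by rewrite -[_ *+ k]mulr_natr; ring.
by elim: k => [|k <-]; rewrite ?mulr0n ?addr0// mulrSr addrA cosD2pi.
Qed.

Lemma wave_anti v : wave (1 - v) = - wave v.
Proof.
rewrite /wave opprK; have -> : pi * (1 - v) = - (pi * v) + pi by ring.
by rewrite cosDpi cosN opprK.
Qed.

Lemma wave_low v : 0 <= v <= 1 / 3 -> wave v <= - rise.
Proof.
move=> v3; rewrite lerN2 leNgt ltr_cos; have := pi_gt0 R.
all: rewrite ?in_itv /=; nra.
Qed.

Lemma wave_high v : 2 / 3 <= v <= 1 -> rise <= wave v.
Proof.
move=> v3; rewrite -[v](subKr 1) wave_anti lerNr; apply: wave_low; lra.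
Qed.

Lemma wave_le0 v : - (1 / 2) <= v <= 1 / 2 -> wave v <= 0.
Proof.
by move=> v2; rewrite oppr_le0; apply: cos_ge0_pihalf; have := pi_gt0 R; nra.
Qed.

Lemma wave_ge0 v : 1 / 2 <= v <= 3 / 2 -> 0 <= wave v.
Proof.
by move=> v2; rewrite -[v](subKr 1) wave_anti oppr_ge0; apply: wave_le0; lra.
Qed.

(** The interval [[0, 2M+1]] begins and ends with a rising stretch, so a falling
    stretch always has a rising stretch on both sides.  A point on the lower half
    of the wave sees, on its right, the top third of the nearest rising stretch (the
    one that it lies on, or the next one); a point on the upper half sees, on
    its left, the bottom third of one.  That third is the interval starting at
    [a].  Near the two ends, where points are missing on one side, the required
    third lies on the other side. *)
Lemma wave_sees_rise (M : nat) (u0 : R) : 0 <= u0 <= 2 * M%:R + 1 ->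
  exists a : R, [/\ 0 <= a, a + 1 / 3 <= 2 * M%:R + 1 &
    forall u, a <= u <= a + 1 / 3 -> `|u - u0| < 2 /\
      ((u0 < u /\ rise <= wave u - wave u0) \/
       (u < u0 /\ rise <= wave u0 - wave u))].
Proof.
move=> /andP[u0_ge0 u0_le].
have /truncn_itv/andP[] : 0 <= u0 / 2 by lra.
set k := Num.truncn _ => k_le; rewrite -[k.+1%:R]natr1 => k_gt.
have k0 : 0 <= k%:R :> R by [].
(* [v] is the phase of [u0] within its period. *)
pose v := u0 - 2 * k%:R.
have wu0 : wave u0 = wave v by rewrite -(waveD2n k v) /v subrKC.
have [v0 v2] : 0 <= v /\ v < 2 by rewrite /v; split; lra.
have kM : (k <= M)%N.
  rewrite -ltnS -(ltr_nat R) -[M.+1%:R]natr1; rewrite /v in v0; lra.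
have {}kM : k%:R <= M%:R :> R by rewrite ler_nat.
have [v12|v12] := leP v (1 / 2).
  exists (2 * k%:R + 2 / 3); split; [lra..|move=> u hu].
  have wu : rise <= wave u.
    by rewrite -[u](subrKC (2 * k%:R)) waveD2n; apply: wave_high; lra.
  have : wave v <= 0 by apply: wave_le0; lra.
  by rewrite wu0 ltr_norml /v in v12 *; split; [|left]; lra.
have [v32|v32] := leP v (3 / 2).
  exists (2 * k%:R); split; [lra..|move=> u hu].
  have wu : wave u <= - rise.
    by rewrite -[u](subrKC (2 * k%:R)) waveD2n; apply: wave_low; lra.
  have : 0 <= wave v by apply: wave_ge0; lra.
  by rewrite wu0 ltr_norml /v in v12 v32 *; split; [|right]; lra.
(* The falling stretch of [u0] cannot be the one after the end [2M+1]. *)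
have {}kM : k%:R + 1 <= M%:R :> R.
  rewrite natr1 ler_nat ltn_neqAle -(ler_nat R) kM andbT.
  by apply/eqP => kE; rewrite /v kE in v32; lra.
exists (2 * k.+1%:R + 2 / 3); rewrite -[k.+1%:R]natr1; split; [lra..|move=> u hu].
have wu : rise <= wave u.
  by rewrite -[u](subrKC (2 * k.+1%:R)) waveD2n; apply: wave_high; rewrite -[k.+1%:R]natr1; lra.
have : wave v <= 0.
  have -> : wave v = wave (v - 2) by rewrite -(waveD2n 1 (v - 2)) mulr1 subrKC.
  by apply: wave_le0; lra.
by rewrite wu0 ltr_norml /v in v12 v32 v2 *; split; [|left]; lra.
Qed.

Lemma wave_sees_fall u0 : 0 <= u0 -> exists u1 u2 : R,
  [/\ u0 <= u1, u1 < u2, u2 <= u0 + 4 & wave u1 - wave u2 = 2].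
Proof.
move=> u0_ge0; have /truncn_itv/andP[] : 0 <= u0 / 2 by lra.
set k := Num.truncn _ => k_le; rewrite -[k.+1%:R]natr1 => k_gt.
exists (2 * k.+1%:R + 1), (2 * k.+2%:R + 0).
rewrite !waveD2n -[k.+2%:R]natr1 -[k.+1%:R]natr1 /wave mulr1 mulr0 cospi cos0; split; lra.
Qed.

End wave.

(** * Perturbation by a zigzag *)

Section perturbation.
Context {R : realType}.

(** The bound 1/12 is the share of an interval of length 1/3 in a window of
    radius 2; these are the sizes in [wave_sees_rise]. *)
Definition sparse_at_scale (n : nat) : set (C01 R) :=
  [set f | exists x0 : I01 R, forall r : R, 0 < r < n.+1%:R^-1 ->
     (density_in (nonneg_slope_set f x0) `](pt x0 - r)%R, (pt x0 + r)%R[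
        < (1 / 12)%:E)%E].

Definition increasing_at_scale (n : nat) : set (C01 R) :=
  [set f | exists x y : I01 R,
     n.+1%:R^-1 <= pt y - pt x /\ increasing_on f `[pt x, pt y]].

Definition add_wave (f : C01 R) (A m : R) (x : I01 R) : R :=
  f x + A * wave (m * pt x).

Lemma add_wave_continuous (f : C01 R) (A m : R) : continuous (add_wave f A m).
Proof.
move=> x; have cf := @cts_fun _ _ f x.
have cp : pt y @[y --> x] --> pt x := pt_continuous x.
have cw : wave (m * pt y) @[y --> x] --> wave (m * pt x).
  exact: continuous_cvg _ (wave_continuous _) (cvgM (cvg_cst m) cp).
exact: cvgD cf (cvgM (cvg_cst A) cw).
Qed.

Definition waved (f : C01 R) (A m : R) : C01 R :=
  mkcts (add_wave_continuous f A m).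

Lemma sup_dist_waved (f : C01 R) (A m : R) : 0 <= A -> sup_dist f (waved f A m) <= A.
Proof.
move=> A0; apply: sup_dist_le => x; rewrite /= /mkcts /add_wave.
rewrite opprD addrA subrr add0r normrN normrM ger0_norm//.
by rewrite -[leRHS]mulr1 ler_wpM2l// norm_wave_le1.
Qed.

(** The added wave dominates: of the gain [A * rise] from [y] to [x], the
    oscillation of [f] takes less than a half and the two errors below
    [A * rise / 4] take less than
    the rest. *)
Lemma waved_follows_wave (f h : C01 R) (A m : R) (x y : I01 R) :
  0 < A -> sup_dist (waved f A m) h < A * rise / 4 ->
  `|f x - f y| < A * rise / 2 ->
  rise <= wave (m * pt x) - wave (m * pt y) -> h y < h x.
Proof.
move=> A0 gh fxy wxy.
have := le_lt_trans (sup_dist_ge (waved f A m) h x) gh.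
have := le_lt_trans (sup_dist_ge (waved f A m) h y) gh.
have := ler_wpM2l (ltW A0) wxy.
move: fxy; rewrite /= /mkcts /add_wave !ltr_norml mulrBr; lra.
Qed.

(** In the window of radius [2 / m] around [x0], the third of a rising stretch
    given by [wave_sees_rise] consists of points of nonnegative slope; the odd
    value of [m] makes [[0, m]] start and end with a rising stretch. *)
Lemma waved_not_sparse (f h : C01 R) (A r0 m : R) (n M : nat) :
  0 < A -> r0 < n.+1%:R^-1 -> m = 2 * M%:R + 1 -> 4 / m < r0 ->
  (forall x y : I01 R, `|pt x - pt y| < r0 -> `|f x - f y| < A * rise / 2) ->
  sup_dist (waved f A m) h < A * rise / 4 -> ~ sparse_at_scale n h.
Proof.
move=> A0 r0n mE mr0 fr0 gh [x0].
have m0 : 0 < m by rewrite mE ltr_wpDl// mulr_ge0.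
have mV0 : 0 < m^-1 by rewrite invr_gt0.
move=> /(_ (2 / m)) hx0; have : 0 < 2 / m < n.+1%:R^-1.
  by rewrite divr_gt0//=; apply: lt_trans r0n; lra.
move/hx0; rewrite ltNge => /negP; apply.
have u0m : 0 <= m * pt x0 <= m.
  by rewrite mulr_ge0 ?pt_ge0 ?(ltW m0)//= ger_pMr// pt_le1.
have [a [a0 am wa]] := wave_sees_rise M (m * pt x0) ltac:(lra).
have ta (t : R) : a / m <= t <= (a + 1 / 3) / m -> a <= m * t <= a + 1 / 3.
  by rewrite ler_pdivrMr// ler_pdivlMr// [m * t]mulrC.
have tx0 (t : R) : a / m <= t <= (a + 1 / 3) / m -> `|t - pt x0| < 2 / m.
  move=> /ta/wa[+ _]; rewrite -mulrBr normrM (gtr0_norm m0) ltr_pdivlMr//.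
  by rewrite mulrC.
have -> : (1 / 12 : R) = ((a + 1 / 3) / m - a / m) / (2 * (2 / m)).
  by field; rewrite gt_eqF.
apply: density_in_ge => [||t /=|t /=]; rewrite ?in_itv /=.
- by rewrite divr_gt0.
- by rewrite ler_pM2r//; lra.
- move=> tJ; have [y yt] : exists y : I01 R, pt y = t.
    apply: pt_surj; move: (ta _ tJ) => tm.
    apply/andP; split.
      by rewrite -(pmulr_rge0 _ m0); lra.
    by rewrite -(ler_pM2l m0) mulr1; lra.
  rewrite -yt in tJ *; apply: mem_slope.
  have yx0 : `|pt y - pt x0| < r0 by have := tx0 _ tJ; lra.
  have [_ [[ly wy]|[ly wy]]] := wa _ (ta _ tJ); [left|right].
    split; first by rewrite ltr_pM2l in ly.
    apply/ltW; apply: waved_follows_wave gh _ wy => //; exact: fr0.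
  split; first by rewrite ltr_pM2l in ly.
  by apply/ltW; apply: waved_follows_wave gh _ wy => //; apply: fr0; rewrite distrC.
- by move=> /tx0; rewrite ltr_norml; lra.
Qed.

(** A length of [4 / m] contains a whole falling stretch of the wave. *)
Lemma waved_not_increasing (f h : C01 R) (A r0 m : R) (n : nat) :
  0 < A -> r0 < n.+1%:R^-1 -> 0 < m -> 4 / m < r0 ->
  (forall x y : I01 R, `|pt x - pt y| < r0 -> `|f x - f y| < A * rise / 2) ->
  sup_dist (waved f A m) h < A * rise / 4 -> ~ increasing_at_scale n h.
Proof.
move=> A0 r0n m0 mr0 fr0 gh [x [y [/(lt_le_trans r0n) xy h_incr]]].
have [u1 [u2 [xu1 u12 u2x w12]]] : exists u1 u2 : R,
    [/\ m * pt x <= u1, u1 < u2, u2 <= m * pt x + 4 & wave u1 - wave u2 = 2].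
  by apply: wave_sees_fall; rewrite mulr_ge0 ?pt_ge0// ltW.
have xt1 : pt x <= u1 / m by rewrite ler_pdivlMr// mulrC.
have t12 : u1 / m < u2 / m by rewrite ltr_pM2r// invr_gt0.
have t2x : u2 / m <= pt x + 4 / m.
  by rewrite ler_pdivrMr// mulrDl divfK ?gt_eqF// mulrC.
have [x_ge0 y_le1] := (pt_ge0 x, pt_le1 y).
have [t1 t1E] : exists t : I01 R, pt t = u1 / m by apply: pt_surj; lra.
have [t2 t2E] : exists t : I01 R, pt t = u2 / m by apply: pt_surj; lra.
have : h t1 <= h t2.
  by apply: h_incr; rewrite /= ?in_itv /= ?t1E ?t2E //; lra.
apply/negP; rewrite -ltNge.
apply: waved_follows_wave gh _ _ => //.
  by apply: fr0; rewrite t1E t2E ltr_norml; lra.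
rewrite t1E t2E ![m * (_ / m)]mulrC !divfK ?gt_eqF// w12.
by have : rise <= 1 :> R := cos_le1 _; lra.
Qed.

Lemma nowhere_dense_exceptional (n : nat) :
  nowhere_dense (sparse_at_scale n `|` increasing_at_scale n).
Proof.
apply: nowhere_dense_ball => f e e0.
pose A := e / 2; have A0 : 0 < A by rewrite divr_gt0.
have rise0 : 0 < rise :> R := rise_gt0.
have Ar0 : 0 < A * rise by rewrite mulr_gt0.
have [r0 [r0_gt0 r0n fr0]] : exists r0 : R, [/\ 0 < r0, r0 < n.+1%:R^-1 &
    forall x y : I01 R, `|pt x - pt y| < r0 -> `|f x - f y| < A * rise / 2].
  near (0 : R)^'+ => r0; exists r0; split.
  - by near: r0; exact: nbhs_right_gt.
  - by near: r0; apply: nbhs_right_lt; rewrite invr_gt0.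
  - by near: r0; apply: C01_unif_continuous; lra.
pose M := Num.truncn (4 / r0); have M0 : 0 <= M%:R :> R by [].
have m0 : 0 < 2 * M%:R + 1 :> R by lra.
have mr0 : 4 / (2 * M%:R + 1) < r0.
  rewrite ltr_pdivrMr//.
  have : 4 / r0 < M.+1%:R by rewrite truncnS_gt.
  by rewrite ltr_pdivrMr// -[M.+1%:R]natr1 mulrC; nra.
exists (waved f A (2 * M%:R + 1)); split.
  by apply: le_lt_trans (sup_dist_waved _ _ _ (ltW A0)) _; rewrite /A; lra.
exists (A * rise / 4) => [|h gh [|]]; first by lra.
  exact: (waved_not_sparse f h A r0 _ n M A0 r0n erefl mr0 fr0 gh).
exact: (waved_not_increasing f h A r0 _ n A0 r0n m0 mr0 fr0 gh).
Unshelve. all: by end_near.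
Qed.

End perturbation.

(** * The typical function *)

Lemma small_nat_inv (R : realType) (r : R) : 0 < r -> exists n : nat, n.+1%:R^-1 < r.
Proof.
move=> r0; exists (Num.truncn r^-1).
by rewrite invf_plt ?posrE// truncnS_gt.
Qed.

Theorem corollary7 (R : realType) :
  residual [set f : C01 R |
    (forall x0 : I01 R, ~ has_density (nonneg_slope_set f x0) (pt x0) 0%E) /\
    ~ (exists I : set R,
         [/\ nondegenerate_interval I, I `<=` `[0, 1] & increasing_on f I])].
Proof.
apply: (residual_of_nowhere_dense_cover _ _ _ nowhere_dense_exceptional) => f /=.
move=> /not_andP[/existsNP[x0 /contrapT dens0]|].
  have c0 : 0 < 1 / 12 :> R by lra.
  have [s s0 hs] := has_density0_lt _ _ _ c0 dens0.
  have [n ns] := small_nat_inv R s s0.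
  exists n => //; left; exists x0 => r /andP[r0 rn]; apply: hs => //.
  by rewrite /ball_ /= sub0r normrN gtr0_norm// (lt_trans rn).
move=> /contrapT[I [[I_itv [x [y [Ix Iy xy]]]] I01 fI]].
have [n ns] := small_nat_inv R (y - x) ltac:(lra).
have /= x01 := I01 _ Ix; have /= y01 := I01 _ Iy.
rewrite !in_itv /= in x01 y01.
have [tx txE] := pt_surj _ x01; have [ty tyE] := pt_surj _ y01.
exists n => //; right; exists tx, ty; rewrite txE tyE; split; first exact: ltW.
move=> u v; rewrite /= !in_itv /= => uxy vxy uv; apply: fI => //.
  exact: I_itv Ix Iy _ uxy.
exact: I_itv Ix Iy _ vxy.
Qed.
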